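(* Let $\mathbb{F}$ be a field and let $\mathcal{E}$ be an evolution algebra over $\mathbb{F}$ such that $\mathcal{E}=\mathcal{E}^2$. Then the group $\mathrm{Aut}(\mathcal{E})$ of algebra automorphisms of $\mathcal{E}$ is finite.
   Context: An algebra over a field $\mathbb{F}$ (arbitrary) is a finite-dimensional $\mathbb{F}$-vector space with a bilinear multiplication (not necessarily associative or unital). An evolution algebra is an algebra $\mathcal{E}$ with a vector space basis $\{e_1,\ldots,e_n\}$ such that $e_ie_j=0=e_je_i$ for all $i\neq j$; such a basis is called a natural basis. $\mathcal{E}^2$ denotes the linear span of all products $xy$ with $x,y\in\mathcal{E}$. Automorphisms are $\mathbb{F}$-linear bijections preserving the product. *)

(* Defs.v *)
From mathcomp Require Import all_boot all_order all_algebra.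
From mathcomp Require Import boolp classical_sets cardinality.

Set Implicit Arguments.
Unset Strict Implicit.
Unset Printing Implicit Defensive.

Import GRing.Theory.

Local Open Scope classical_set_scope.
Local Open Scope ring_scope.

(* An algebra is a [vectType] [E] together with a product bundled as a bilinear
   map; no associativity, commutativity or unit is assumed, which is why the
   library's [falgType] is not used. *)

Definition natural_basis (F : fieldType) (E : vectType F)
    (mul : {bilinear E -> E -> E}) (n : nat) (e : n.-tuple E) : Prop :=
  basis_of {:E} e /\ forall i j : 'I_n, i != j -> mul (tnth e i) (tnth e j) = 0.

Definition evolution_algebra (F : fieldType) (E : vectType F)
    (mul : {bilinear E -> E -> E}) : Prop :=
  exists (n : nat) (e : n.-tuple E), natural_basis mul e.

(* E^2: the finite linear combinations of products of two arbitrary elements. *)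
Definition alg_square (F : fieldType) (E : vectType F)
    (mul : {bilinear E -> E -> E}) : set E :=
  [set z | exists (m : nat) (c : 'I_m -> F) (x y : 'I_m -> E),
             z = \sum_(k < m) c k *: mul (x k) (y k)].

(* ['End(E)] is the type of linear maps E -> E, with extensional equality. *)
Definition alg_Aut (F : fieldType) (E : vectType F)
    (mul : {bilinear E -> E -> E}) : set 'End(E) :=
  [set f | bijective f /\ forall x y : E, f (mul x y) = mul (f x) (f y)].

(* Main.v *)
(** Write e_i^2 = \sum_j w_ij e_j.  Since the squares e_i^2 span E, the matrix
    (w_ij) is invertible.  If f is an automorphism, then f(e_i) f(e_j) = 0 for
    i != j, and independence of the squares forces the supports of f(e_i) and
    f(e_j) to be disjoint, so f(e_i) = a_i e_(s i) for a permutation s.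
    Comparing f(e_i^2) with f(e_i)^2 gives w_ij a_j = a_i^2 w_(s i)(s j).  A
    nonzero term of the determinant of (w_ij) is a permutation p with
    w_(i, p i) != 0, whence a_(p i) = c_i a_i^2 with c depending only on s.
    Going N = #[p] times around p, a_i is a root of C X^(2^N) - X for some C
    depending only on s and i, which leaves finitely many choices. *)
Require Import Defs.
From mathcomp Require Import all_boot all_order all_algebra.
From mathcomp Require Import fingroup perm.
From mathcomp Require Import boolp classical_sets cardinality.

Set Implicit Arguments.
Unset Strict Implicit.
Unset Printing Implicit Defensive.

Local Open Scope classical_set_scope.
Local Open Scope ring_scope.

Import GRing.Theory.

Lemma finite_roots (R : idomainType) (p : {poly R}) :
  p != 0 -> finite_set [set x | root p x].
Proof.
move=> p_neq0; apply: contrapT => /(infinite_set_fset (size p))[B Bp].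
(* An infinite root set would contain [size p] distinct roots, one more than the degree allows. *)
apply/negP; rewrite -ltnNge; apply: max_poly_roots => //.
  by apply/allP => x xB; apply: Bp.
exact: finmap.fset_uniq.
Qed.

Lemma finite_ffun (I : finType) (T : choiceType) (A : set T) :
  finite_set A -> finite_set [set g : {ffun I -> T} | forall i, A (g i)].
Proof.
move=> /finite_seqP[s ->].
pose h (u : {ffun I -> seq_sub s}) := [ffun i => ssval (u i)].
apply: (sub_finite_set _ (finite_image h (@finite_finset _ [set: _]))).
move=> g gs; exists [ffun i => SeqSub (gs i)] => //.
by apply/ffunP => i; rewrite !ffunE.
Qed.

(** The quantifier order matters: [C] is chosen before [a], so one constant serves all solutions of
    the recurrence. *)
Lemma iter_quadratic (R : comNzRingType) (I : finType) (p : {perm I})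
    (c : I -> R) (i : I) (m : nat) :
  exists C, forall a : I -> R, (forall j, a (p j) = c j * a j ^+ 2) ->
    a (iter m p i) = C * a i ^+ (2 ^ m).
Proof.
elim: m => [|m [C IHm]]; first by exists 1 => a _; rewrite mul1r.
exists (c (iter m p i) * C ^+ 2) => a aP.
by rewrite iterS aP (IHm a) // exprMn -exprM expnSr mulrA.
Qed.

Lemma finite_quadratic_cycle (R : idomainType) (I : finType) (p : {perm I})
    (c : I -> R) (i : I) :
  finite_set [set a i | a in [set a : I -> R |
                              forall j, a (p j) = c j * a j ^+ 2]].
Proof.
have [C CP] := iter_quadratic p c i #[p]%g.
pose q : {poly R} := C *: 'X^(2 ^ #[p]%g) - 'X.
have q_neq0 : q != 0.
  (* The coefficient of X in [q] is -1 whatever [C] is, because #[p] > 0 gives 2 ^ #[p] > 1. *)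
  apply: contra_neq (oner_neq0 R) => /(congr1 (coefp 1)) /=.
  rewrite coefB coefZ coefXn coefX coef0 ltn_eqF.
    by rewrite mulr0 sub0r => /eqP; rewrite oppr_eq0 => /eqP.
  by rewrite -(expn0 2) ltn_exp2l // order_gt0.
apply: sub_finite_set (finite_roots q_neq0) => _ [a aP <-] /=.
rewrite rootE hornerD hornerN hornerZ hornerXn hornerX -CP //.
by rewrite -permX expg_order perm1 subrr.
Qed.

(** Otherwise every term of the Leibniz expansion of the determinant has a zero factor. *)
Lemma unitmx_transversal (R : comUnitRingType) (n : nat) (A : 'M[R]_n) :
  A \in unitmx -> exists p : 'S_n, forall i, A i (p i) != 0.
Proof.
rewrite unitmxE => Aunit; apply/not_existsP => noP.
suff detA0 : \det A = 0 by rewrite detA0 unitr0 in Aunit.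
rewrite /determinant big1 // => p _.
have /existsNP[i /negP/negPn/eqP Ai0] := noP p.
by rewrite (bigD1 i) //= Ai0 mul0r mulr0.
Qed.

Section EvolutionAlgebra.

Context {F : fieldType} {E : vectType F} (mul : {bilinear E -> E -> E}).
Context {n : nat} (e : n.-tuple E) (e_nat : natural_basis mul e).

Let e_basis : basis_of {:E} e := e_nat.1.
Let e_free : free e := basis_free e_basis.

Definition structure_mx : 'M[F]_n :=
  \matrix_(i, j) coord e j (mul (tnth e i) (tnth e i)).

Let coordE v : v = \sum_i coord e i v *: tnth e i.
Proof.
rewrite {1}(coord_basis e_basis (memvf v)).
by apply: eq_bigr => i _; rewrite -tnth_nth.
Qed.

Let coord_tnth i j : coord e j (tnth e i) = (i == j)%:R.
Proof. by rewrite (tnth_nth 0) coord_free. Qed.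

Lemma eq_coord u v : (forall i, coord e i u = coord e i v) -> u = v.
Proof.
by move=> uv; rewrite (coordE u) (coordE v); apply: eq_bigr => i _; rewrite uv.
Qed.

Lemma mul_natural_basis x y :
  mul x y =
  \sum_i (coord e i x * coord e i y) *: mul (tnth e i) (tnth e i).
Proof.
rewrite {1}(coordE x) linear_sumlz; apply: eq_bigr => i _.
rewrite linearZl_LR {1}(coordE y) linear_sumr (bigD1 i) //= big1 => [|j ji].
  by rewrite addr0 linearZr_LR scalerA.
by rewrite linearZr_LR e_nat.2 ?scaler0 // eq_sym.
Qed.

(** The product is the coordinatewise product followed by a fixed linear map; once that map is
    invertible, a zero product forces disjoint supports. *)
Lemma coord_mul x y :
  \row_j coord e j (mul x y) =
  (\row_i (coord e i x * coord e i y)) *m structure_mx.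
Proof.
apply/rowP => j; rewrite !mxE mul_natural_basis linear_sum.
by apply: eq_bigr => i _; rewrite linearZ !mxE.
Qed.

Lemma structure_mx_unit : [set: E] = alg_square mul -> structure_mx \in unitmx.
Proof.
move=> E_square; rewrite -row_full_unit -sub1mx; apply/row_subP => i.
have : alg_square mul (tnth e i) by rewrite -E_square.
move=> [m [c [x [y e_i]]]].
have -> : row i 1%:M =
    \sum_(k < m) c k *: (\row_j coord e j (mul (x k) (y k))).
  apply/rowP => j; rewrite !mxE -coord_tnth e_i linear_sum summxE.
  by apply: eq_bigr => k _; rewrite linearZ !mxE.
by apply: summx_sub => k _; rewrite scalemx_sub // coord_mul submxMl.
Qed.

Lemma alg_Aut_monomial (f : 'End(E)) :
    structure_mx \in unitmx -> alg_Aut mul f ->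
  exists (s : 'S_n) (a : 'I_n -> F), forall i, f (tnth e i) = a i *: tnth e (s i).
Proof.
move=> W_unit [/bij_inj f_inj f_mul].
have disj i j k : i != j ->
    coord e k (f (tnth e i)) * coord e k (f (tnth e j)) = 0.
  move=> /e_nat.2 eij.
  have := coord_mul (f (tnth e i)) (f (tnth e j)).
  rewrite -f_mul eij linear0 => /(congr1 (mulmx^~ (invmx structure_mx))).
  rewrite mulmxK // => /rowP/(_ k); rewrite [in RHS]mxE => <-.
  rewrite (_ : \row__ _ = 0) ?mul0mx ?mxE //.
  by apply/rowP => l; rewrite !mxE linear0.
have supp i : exists k, coord e k (f (tnth e i)) != 0.
  apply: contrapT => /forallNP fi0.
  have : tnth e i = 0.
    apply: f_inj; rewrite linear0; apply: eq_coord => k; rewrite linear0.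
    by apply/eqP/negPn/negP/fi0.
  move=> /(congr1 (coord e i)); rewrite coord_tnth eqxx linear0.
  by apply/eqP/oner_neq0.
(* Choose one index in each support; disjointness of the supports makes the choice injective, hence
   a permutation. *)
have [s sP] := fin_all_exists supp.
have s_inj : injective s.
  move=> i j sij; apply/eqP; apply: contraT => /(disj _ _ (s i))/eqP.
  by rewrite mulf_eq0 {2}sij !(negPf (sP _)).
exists (perm s_inj), (fun i => coord e (s i) (f (tnth e i))) => i.
apply: eq_coord => k; rewrite linearZ /= coord_tnth permE.
have [<-|sik] := eqVneq; first by rewrite mulr1.
(* By surjectivity k = s (s' k) lies in the support of the image of the basis vector of index s' k,
   which is disjoint from that of index i. *)
have [s' _ s'K] := injF_bij s_inj; rewrite mulr0.
have {}sik : i != s' k by apply: contra_neq sik => ->.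
have /eqP := disj _ _ k sik; rewrite mulf_eq0 => /predU1P[-> //|].
by rewrite -{1}[k]s'K (negPf (sP _)).
Qed.

Lemma alg_Aut_structure_mx (f : 'End(E)) (s : 'S_n) (a : 'I_n -> F) :
    alg_Aut mul f -> (forall i, f (tnth e i) = a i *: tnth e (s i)) ->
  forall i j, structure_mx i j * a j = structure_mx (s i) (s j) * a i ^+ 2.
Proof.
move=> [_ f_mul] f_e i j.
have := f_mul (tnth e i) (tnth e i) => /(congr1 (coord e (s j))).
rewrite f_e linearZl_LR linearZr_LR scalerA -expr2 linearZ /=.
(* As [s] is injective, only the j-th term contributes to coordinate [s j]. *)
rewrite (coordE (mul (tnth e i) _)) !linear_sum (bigD1 j) //= big1 => [|k kj].
  rewrite addr0 linearZ linearZ /= f_e linearZ /= coord_tnth eqxx mulr1.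
  by rewrite !mxE => ->; rewrite mulrC.
rewrite linearZ linearZ /= f_e linearZ /= coord_tnth (inj_eq perm_inj).
by rewrite (negPf kj) !mulr0.
Qed.

Lemma finite_alg_Aut : [set: E] = alg_square mul -> finite_set (alg_Aut mul).
Proof.
move=> /structure_mx_unit W_unit.
have [p pP] := unitmx_transversal W_unit.
pose c (s : 'S_n) i :=
  structure_mx (s i) (s (p i)) / structure_mx i (p i).
(* A finite set holding every matrix entry of every automorphism: zeros off the permutation pattern,
   and the possible scalars for each [s] and [i]. *)
pose S := [set 0] `|` \bigcup_(si in [set: 'S_n * 'I_n])
  [set a si.2 | a in [set a : 'I_n -> F |
                      forall j, a (p j) = c si.1 j * a j ^+ 2]].
have S_fin : finite_set S.
  rewrite finite_setU; split; first exact: finite_set1.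
  apply: bigcup_finite => [|[s i] _]; first exact: finite_finset.
  exact: finite_quadratic_cycle.
(* The matrix of [f] in the basis [e] determines [f], so it suffices to confine its entries to
   [S]. *)
pose coords (f : 'End(E)) : {ffun 'I_n * 'I_n -> F} :=
  [ffun ik => coord e ik.2 (f (tnth e ik.1))].
have coords_inj : injective coords.
  move=> f g /ffunP fg; apply/lfunP => v; rewrite (coordE v) !linear_sum.
  apply: eq_bigr => i _; rewrite !linearZ; congr (_ *: _).
  by apply: eq_coord => k; have := fg (i, k); rewrite !ffunE.
apply: (sub_finite_set _ (finite_preimage (in2W coords_inj)
  (finite_ffun ('I_n * 'I_n)%type S_fin))).
move=> f f_aut [i k]; rewrite ffunE /=.
have [s [a f_e]] := alg_Aut_monomial W_unit f_aut.
rewrite f_e linearZ /= coord_tnth.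
have [_|_] := eqVneq; last by left; rewrite mulr0.
right; exists (s, i) => //=; exists a; last by rewrite mulr1.
move=> j; apply: (mulfI (pP j)).
by rewrite (alg_Aut_structure_mx f_aut f_e) [RHS]mulrCA mulrA divfK.
Qed.

End EvolutionAlgebra.

Theorem theorem4p8 (F : fieldType) (E : vectType F)
    (mul : {bilinear E -> E -> E})
    (E_evolution : evolution_algebra mul)
    (E_square : [set: E] = alg_square mul) :
  finite_set (alg_Aut mul).
Proof. by have [n [e e_nat]] := E_evolution; apply: finite_alg_Aut e_nat _. Qed.
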